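(* Let $\{e_j\}_{j\in\mathbb{N}_0}$ be unit vectors in a Hilbert space $\mathscr{H}$, let $P_j=|e_j\rangle\langle e_j|$ be the rank-one projection onto the span of $e_j$, and set $Q_0=P_0$, $Q_n=P_n(1-P_{n-1})\cdots(1-P_0)$ for $n\ge 1$. Let $g_j\in\mathscr{H}$ be the unique vector such that $$Q_j=|e_j\rangle\langle g_j|,\qquad j\in\mathbb{N}_0.$$ Then the vectors $\{g_j\}$ are determined recursively by $$g_0=e_0,\qquad g_n=e_n-\sum_{j=0}^{n-1}\langle e_j,e_n\rangle g_j\quad(n\ge1).$$
   Context: $\mathbb{N}_0=\{0,1,2,\dots\}$. The inner product is linear in the second variable. Dirac notation: for $u,v\in\mathscr{H}$, $|u\rangle\langle v|$ is the operator $x\mapsto\langle v,x\rangle u$. The symbol $1$ denotes the identity operator. Each $Q_j$ has range in the span of $e_j$, so that the vector $g_j$ exists and is unique. *)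

(* Defs.v *)
From HB Require Import structures.
From mathcomp Require Import all_boot all_order all_algebra sesquilinear.
From mathcomp Require Import all_classical all_reals all_analysis.
From mathcomp Require Import complex.

Set Implicit Arguments.
Unset Strict Implicit.
Unset Printing Implicit Defensive.

Import Order.TTheory GRing.Theory Num.Theory.
Import numFieldNormedType.Exports.

Local Open Scope ring_scope.
Local Open Scope complex_scope.

Section Kaczmarz.
Context {R : realType} {H : completeNormedModType R[i]}.
Implicit Types (dot : {dot H for Num.conj}) (e : nat -> H) (n : nat).

(* A dot form of sesquilinear.v is linear in its first argument and
   conjugate-linear in its second one, hence the swap: [inner dot u v] is
   linear in [v]. *)
Definition inner dot (u v : H) : R[i] := dot v u.

(* [dot] is the inner product of the Hilbert space [H]: it induces the norm
   for which [H] is complete. *)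
Definition induces_norm dot := forall x : H, `|x| ^+ 2 = inner dot x x.

Definition ketbra dot (u v : H) : H -> H := fun x => inner dot v x *: u.

Definition P dot e n : H -> H := ketbra dot (e n) (e n).

(* (1 - P_{n-1}) ... (1 - P_0), the identity for n = 0 *)
Fixpoint residual dot e n : H -> H :=
  if n is m.+1 then (id \- P dot e m) \o residual dot e m else id.

Definition Q dot e n : H -> H := P dot e n \o residual dot e n.

End Kaczmarz.

(* Main.v *)
Require Import Defs.
From HB Require Import structures.
From mathcomp Require Import all_boot all_order all_algebra sesquilinear.
From mathcomp Require Import all_classical all_reals all_analysis.
From mathcomp Require Import complex.

Set Implicit Arguments.
Unset Strict Implicit.
Unset Printing Implicit Defensive.

Import Order.TTheory GRing.Theory Num.Theory.
Import numFieldNormedType.Exports.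

Local Open Scope ring_scope.
Local Open Scope complex_scope.

(** Since [P_m] applied after the [m]-th residual is [Q_m], the residuals
telescope: [residual n = 1 - Q_0 - ... - Q_(n-1)]. Substituting
[Q_j = |e_j><g_j|] into [Q_n = P_n (residual n)] and reading off the
coefficient of [e_n <> 0] gives, for every vector [x],
[<g_n, x> = <e_n, x> - sum_(j < n) <e_n, e_j> <g_j, x>].
The right-hand side is the inner product with [x] of
[e_n - sum_(j < n) <e_j, e_n> g_j], the scalars being conjugated because the
inner product is antilinear in its first variable; nondegeneracy concludes
([inner_inj]). The case [n = 0] is the same identity with an empty sum. *)

Section InnerProduct.
Context {R : realType} {H : completeNormedModType R[i]}.
Context (dot : {dot H for Num.conj}).
Implicit Types (u v x : H).

Lemma innerC u v : inner dot u v = (inner dot v u)^*%R.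
Proof.
rewrite /inner (hermC (dot : {hermitian H for false & Num.conj})).
by rewrite expr0 mul1r.
Qed.

(** Riesz uniqueness: testing against [u - v] itself, positive definiteness
rules out [u - v <> 0]. This turns the identity of functionals obtained for
[g n] into an identity of vectors. *)
Lemma inner_inj u v : (forall x, inner dot u x = inner dot v x) -> u = v.
Proof.
move=> uv; apply/eqP; rewrite -subr_eq0; apply/negPn/negP => nz.
have := @neq0_dnorm_gt0 _ _ _ dot _ nz.
by rewrite linearBr /= -/(inner dot u _) -/(inner dot v _) uv subrr ltxx.
Qed.

Lemma inner_antilinear_sum n u (c : nat -> R[i]) (f : nat -> H) x :
  inner dot (u - \sum_(j < n) c j *: f j) x =
  inner dot u x - \sum_(j < n) (c j)^*%R * inner dot (f j) x.
Proof.
rewrite /inner linearBr linear_sumr /=; congr (_ - _).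
by apply: eq_bigr => j _; rewrite linearZr.
Qed.

(** Each factor [1 - P_n] removes from the current residual exactly
[P_n (residual n) = Q_n], so the product of the factors becomes a sum,
without any commutation between the [P_j]. *)
Lemma residual_sum (e : nat -> H) n x :
  residual dot e n x = x - \sum_(j < n) Q dot e j x.
Proof.
elim: n => [|n IHn] /=; first by rewrite big_ord0 subr0.
by rewrite big_ord_recr /= opprD addrA -IHn.
Qed.

End InnerProduct.

Theorem corollary3p15 (R : realType) (H : completeNormedModType R[i])
    (dot : {dot H for Num.conj}) (hdot : induces_norm dot)
    (e : nat -> H) (he : forall j, `|e j| = 1)
    (g : nat -> H) (hg : forall j, Q dot e j =1 ketbra dot (e j) (g j)) :
  g 0%N = e 0%N /\
  forall n, (1 <= n)%N ->
    g n = e n - \sum_(j < n) inner dot (e j) (e n) *: g j.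
Proof.
have e_neq0 j : e j != 0 by rewrite -normr_gt0 he.
have rec n : g n = e n - \sum_(j < n) inner dot (e j) (e n) *: g j.
  apply: (@inner_inj _ _ dot) => x.
  rewrite (inner_antilinear_sum _ _ _ (fun j => inner dot (e j) (e n))).
  (* Both sides of [hg n x] are multiples of [e n <> 0]: compare the
     coefficients. *)
  have /eqP := hg n x.
  rewrite /Q /P /ketbra /= -subr_eq0 -scalerBl scaler_eq0 (negPf (e_neq0 n)).
  rewrite orbF subr_eq0 => /eqP <-.
  rewrite residual_sum /inner linearBl linear_sumlz /=; congr (_ - _).
  apply: eq_bigr => j _; rewrite hg /ketbra linearZl_LR /= mulrC.
  by rewrite -/(inner dot (e n) (e j)) innerC.
by split=> [|n _]; [rewrite rec big_ord0 subr0 | exact: rec].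
Qed.
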